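(* Let $A\subset\mathbb{R}^2$ be a regular compact set for which there exists a direction $u\in\mathbb{S}^1$ such that (1) $\lambda_1(A\cap(y+l_u))>0$ for $\lambda_1$-a.e. $y\in\mathrm{conv}(A|u^\perp)$, and (2) $\lambda_1(\{y\in u^\perp: f_{A,u}(y)\ge 2\})>0$, where for $y\in u^\perp$ $$f_{A,u}(y)=\liminf_{h\to 0^+}\frac{\lambda_1\big((A\setminus(A+hu))\cap(y+l_u)\big)}{h}.$$ Then $g_A\ne g_K$ for every convex body $K$ in $\mathbb{R}^2$.
   Context: A closed set is regular if it coincides with the closure of its interior. For a compact set $A\subset\mathbb{R}^2$, the covariogram is $g_A(x)=\lambda_2(A\cap(A+x))$, $x\in\mathbb{R}^2$. A convex body is a compact convex set with non-empty interior. $\lambda_2$ is Lebesgue measure in $\mathbb{R}^2$ and $\lambda_1$ is one-dimensional Lebesgue (Hausdorff) measure on lines. For $u\in\mathbb{S}^1$ (the unit circle), $u^\perp$ is the line through the origin orthogonal to $u$, $l_u$ is the line through the origin parallel to $u$, and $A|u^\perp$ is the orthogonal projection of $A$ on $u^\perp$. $\mathrm{conv}$ denotes convex hull. *)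

(* Defs.v *)
From mathcomp Require Import all_boot all_order all_algebra.
From mathcomp Require Import all_classical all_reals all_analysis.

Set Implicit Arguments.
Unset Strict Implicit.
Unset Printing Implicit Defensive.
Import Order.TTheory GRing.Theory Num.Theory.
Import numFieldNormedType.Exports.

Local Open Scope classical_set_scope.
Local Open Scope ring_scope.

Section Plane.
Variable R : realType.
Implicit Types (A K : set (R * R)) (u v p x y : R * R).

Definition dotp x y : R := x.1 * y.1 + x.2 * y.2.

Definition unit_circle : set (R * R) := [set u | dotp u u = 1].

Definition orth_line u : set (R * R) := [set y | dotp y u = 0].

Definition dir_line u : set (R * R) := [set t *: u | t in [set: R]].

Definition rot u : R * R := (- u.2, u.1).

Definition translate x A : set (R * R) := [set a + x | a in A].

Definition orth_proj u A : set (R * R) := [set a - dotp a u *: u | a in A].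

Definition conv_hull A : set (R * R) := smallest (@convex_set R (R * R)%type) A.

Definition lambda2 : set (R * R) -> \bar R :=
  (@lebesgue_measure R \x @lebesgue_measure R)%E.

(* One-dimensional Lebesgue measure on the line through p with direction v,
   as a function of subsets of the plane; the normalization is the Euclidean
   one only when v is a unit vector. *)
Definition lambda1 p v : set (R * R) -> \bar R :=
  pushforward (@lebesgue_measure R) (fun t : R => p + t *: v).

Definition lambda1_par u y : set (R * R) -> \bar R := lambda1 y u.

(* If u is a unit vector, then so is rot u, and it spans orth_line u. *)
Definition lambda1_orth u : set (R * R) -> \bar R := lambda1 0 (rot u).

Definition covariogram A x : \bar R := lambda2 (A `&` translate x A).

Definition regular_compact A := compact A /\ regclosed A.

Definition convex_body K :=
  [/\ compact K, @convex_set R (R * R)%type K & K° !=set0].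

Definition section_rate A u y : \bar R :=
  limf_einf (fun h : R =>
    (lambda1_par u y ((A `\` translate (h *: u) A) `&` translate y (dir_line u))
     * (h^-1)%:E)%E) 0^'+.

End Plane.

(* Main.v *)
Require Import Defs.
From mathcomp Require Import all_boot all_order all_algebra.
From mathcomp Require Import all_classical all_reals all_analysis.
From mathcomp Require Import measurable_realfun ring lra.
Import Order.TTheory GRing.Theory Num.Theory.
Import numFieldNormedType.Exports.
Local Open Scope classical_set_scope.
Local Open Scope ring_scope.

(* By Fubini in the coordinates (rot u, u), lambda2 (E \ (E + h u)) is the
   integral over s of the length of B \ (B + h), where B runs over the sections
   of E by the lines parallel to u; for compact E it is also g_E(0) - g_E(h u),
   so it is the same for A and K if g_A = g_K.  For K the sections are
   intervals, and the integral is at most h w, where w is the width of K in the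
   direction orthogonal to u.  For A, divide by h = 1/n and apply Fatou's lemma:
   the lower limit of |B \ (B + h)| / h is at least 1 whenever |B| > 0, by
   Lebesgue's density theorem, and at least 2 on a set of positive measure, by
   hypothesis (2).  So the set of those s whose section has positive length has
   measure strictly less than w.  But it has measure at least w: g_A = g_K is
   positive on (1 - t) (K - K) for 0 < t < 1, which is therefore contained in
   A - A; so A is at least as wide as K, and hypothesis (1) applies.

   Rotation invariance of lambda2 comes from writing a rotation as a product of
   three shears. *)

(** * Translates of sets on the real line *)

Section RealLine.
Set Implicit Arguments.
Unset Strict Implicit.
Variable R : realType.
Local Notation leb := (@lebesgue_measure R).
Implicit Types (B C : set R) (h r x : R).

Lemma measurable_preimage_addr B h :
  measurable B -> measurable [set t | B (t + h)].
Proof.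
move=> mB; rewrite -[X in measurable X]setTI.
exact: (measurable_funD (@measurable_id _ _ setT) (measurable_cst h)).
Qed.

Lemma lebesgue_measure_addr B h : measurable B ->
  leb [set t | B (t + h)] = leb B.
Proof.
move=> mB.
pose f (t : R) : measurableTypeR R := t + h.
have mf : measurable_fun setT f.
  exact: (measurable_funD (@measurable_id _ _ setT) (measurable_cst h)).
suff : pushforward leb f B = leb B by [].
apply/esym/lebesgue_measure_unique => //= _ [[a b]] _ <-.
rewrite /pushforward (_ : _ @^-1` _ = `]a - h, b - h]%classic); last first.
  by apply/seteqP; split=> t /=; rewrite !in_itv/= lerBrDr ltrBlDr.
rewrite !lebesgue_measure_itv/= !lte_fin ltrD2r; case: ifP => // _.
by rewrite -!EFinB; congr EFin; lra.
Qed.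

(** [lebesgue_measure] is built as an outer measure, so monotonicity needs no measurability. This
    matters for the set in hypothesis (2), whose measurability is not known. *)
Lemma le_lebesgue_measure B C : B `<=` C -> (leb B <= leb C)%E.
Proof.
move=> BC; rewrite /lebesgue_measure /lebesgue_stieltjes_measure.
by rewrite /measure_extension; apply: le_mu_ext.
Qed.

(* Below [x + r], the measure of [B] exceeds that of its translate by [2r]
   exactly by the measure of [B `&` ball x r]. *)
Lemma shift_setD_ge B x r : measurable B -> (leb B < +oo)%E -> 0 < r ->
  (leb (B `&` ball x r) <= leb (B `\` [set t | B (t - r *+ 2)%R]))%E.
Proof.
move=> mB fB r0.
pose C := B `&` `]-oo, x + r[; pose D := B `&` `]-oo, x - r].
pose D' : set R := [set t | D (t + - (r *+ 2))].
have mC : measurable C by apply: measurableI.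
have mD : measurable D by apply: measurableI.
have mD' : measurable D' by exact: measurable_preimage_addr.
have fD : leb D \is a fin_num.
  rewrite ge0_fin_numE// (le_lt_trans _ fB)//; apply: le_lebesgue_measure.
  exact: subIsetl.
have CE : leb C = (leb (B `&` ball x r) + leb D)%E.
  have mBr : measurable (B `&` ball x r).
    by apply: measurableI => //; exact: measurable_ball.
  rewrite -measureU//; last first.
    apply/seteqP; split=> // t [[_]].
    rewrite ball_itv /= !in_itv/= => /andP[+ _] [_].
    by rewrite /= in_itv/= ltNge => /negP.
  congr leb; apply/seteqP; split=> t; rewrite /C /D ball_itv /= !in_itv/=.
    move=> [Bt tr]; have [tx|xt] := leP t (x - r); first by right.
    by left; split=> //; rewrite xt tr.
  case=> -[Bt]; first by case/andP.
  by move=> tr; split=> //; rewrite (le_lt_trans tr)// ltrD2l gtrN.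
rewrite -(leeD2rE _ _ fD) -CE.
have -> : leb D = leb D' by rewrite [RHS]lebesgue_measure_addr.
apply: (@le_trans _ _ (leb (C `\` D') + leb D')%E).
  rewrite -measureU//; last 2 first.
  - exact: measurableD.
  - by apply/seteqP; split=> // t [[]].
  apply: le_lebesgue_measure => t Ct.
  by have [?|?] := pselect (D' t); [right|left].
(* For [t < x + r] the point [t - r *+ 2] is below [x - r], so if it lay in [B] it would lie in [D],
   and [t] in [D']. *)
apply: leeD2r; apply: le_lebesgue_measure => t [] [Bt].
rewrite /= in_itv/= => tr nD'.
split=> // Bt'; apply: nD'; split=> //=; rewrite in_itv/=.
by rewrite lerBlDr mulr2n addrA subrK ltW.
Qed.

(** * Lower limits and shift rates *)

Lemma limf_einf_le_limn_einf (T : topologicalType) (F : set_system T)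
    (f : T -> \bar R) (u : nat -> T) :
  u @ \oo --> F -> (limf_einf f F <= limn_einf (f \o u))%E.
Proof.
move=> uF; rewrite (_ : limn_einf _ = limf_einf (f \o u) \oo)// !limf_einfE.
apply: ge_ereal_sup => _ [V FV <-].
apply: (@le_trans _ _ (ereal_inf [set (f \o u) n | n in u @^-1` V])).
  apply: ereal_inf_le_tmp => _ [n Vn <-]; by exists (u n).
apply: ereal_sup_ubound; exists (u @^-1` V) => //; exact: uF.
Qed.

Lemma le_limn_einf (f g : nat -> \bar R) : (forall n, (f n <= g n)%E) ->
  (limn_einf f <= limn_einf g)%E.
Proof.
have E (k : nat -> \bar R) : limn_einf k = limf_einf k \oo by [].
move=> fg; rewrite !E !limf_einfE.
apply: ge_ereal_sup => _ [V FV <-].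
apply: (@le_trans _ _ (ereal_inf [set g n | n in V])); last first.
  by apply: ereal_sup_ubound; exists V.
apply: le_ereal_inf_tmp => _ [n Vn <-].
by rewrite (le_trans _ (fg n))//; apply: ereal_inf_lbound; exists n.
Qed.

Lemma cvg_at_right0 (u : nat -> R) : (forall n, 0 < u n) ->
  u n @[n --> \oo] --> 0 -> u n @[n --> \oo] --> 0^'+.
Proof.
move=> u0 cu V nV.
have : nbhs (u n @[n --> \oo]) [set y | 0 < y -> V y] := cu _ nV.
apply: (@filterS _ (nbhs \oo)) => n /=; apply; exact: u0.
Qed.

(** A single density point [x] of [B] suffices: by [shift_setD_ge], the rate is at least the density
    quotient of [B] in a ball around [x], and these quotients tend to 1. *)
Lemma einf_shift_rate_ge1 B :
  measurable B -> (leb B < +oo)%E -> (0 < leb B)%E ->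
  (1 <= limn_einf (fun n => leb (B `\` [set t | B (t - n.+1%:R^-1)%R])
    * ((n.+1%:R^-1)^-1)%:E))%E.
Proof.
move=> mB fB B0.
have [x [Bx dx]] : exists x, B x /\
    (leb (B `&` ball x r) * (leb (ball x r))^-1)%E @[r --> 0^'+] --> 1%E.
  have [N [mN N0 sN]] := lebesgue_density mB.
  apply: contrapT => /forallNP H.
  have : (leb B <= leb N)%E.
    apply: le_lebesgue_measure => x Bx; apply: sN => /= dx.
    by apply: (H x); split=> //; move: dx; rewrite indicE mem_set.
  by rewrite N0 leNgt B0.
(* Half the shift, so that the ball of radius [r n] has length exactly [n.+1%:R^-1] and the
   denominators agree. *)
pose r n : R := 2^-1 * n.+1%:R^-1.
have r0 n : 0 < r n by rewrite mulr_gt0.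
have rE n : r n *+ 2 = n.+1%:R^-1.
  by rewrite /r -[LHS]mulr_natr mulrAC mulVf ?mul1r// pnatr_eq0.
have cr : r n @[n --> \oo] --> 0.
  by rewrite -[X in _ --> X](mulr0 2^-1); apply: cvgM;
    [exact: cvg_cst|exact: cvg_harmonic].
have /cvg_limn_einf_sup[<- _] := (cvge_at_rightP _ _ _).1 dx r (conj r0 cr).
apply: le_limn_einf => n; rewrite lebesgue_measure_ball ?(ltW (r0 n))// rE inver.
rewrite gt_eqF//; apply: lee_wpmul2r; first by rewrite lee_fin ltW// !invr_gt0.
by rewrite -rE; exact: shift_setD_ge.
Qed.

(** If [t] and [t'] are in the difference and [t' < t - h], then [t - h] lies between two points of
    [B], hence in [B], a contradiction. So the difference has diameter at most [h]. *)
Lemma convex_shift_setD_le B h : 0 < h -> is_interval B ->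
  (leb (B `\` [set t | B (t - h)%R]) <= h%:E)%E.
Proof.
move=> h0 iB; set D := B `\` _.
have DD t t' : D t -> D t' -> t - h <= t'.
  move=> [Bt nBt] [Bt' _]; rewrite leNgt; apply/negP => t't; apply: nBt.
  by apply: (iB t' t) => //; rewrite ltW//= gerBl ltW.
have [->|/set0P[t0 Dt0]] := eqVneq D set0; first by rewrite measure0 lee_fin ltW.
pose a := inf D.
have ha : has_inf D by split; [exists t0|exists (t0 - h) => t Dt; exact: DD].
apply: (@le_trans _ _ (leb `[a, (a + h)%R])).
  apply: le_lebesgue_measure => t Dt; rewrite /= in_itv/=.
  apply/andP; split; first exact: (ge_inf ha.2).
  rewrite -lerBlDr; apply: lb_le_inf; first by exists t0.
  by move=> t' Dt'; exact: DD.
rewrite lebesgue_measure_itv/= lte_fin ltrDl h0 -EFinB lee_fin.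
lra.
Qed.

End RealLine.

(** * Maps preserving planar Lebesgue measure *)

Section Plane.
Set Implicit Arguments.
Unset Strict Implicit.
Variable R : realType.
Local Notation leb := (@lebesgue_measure R).
Local Notation lambda2 := (@lambda2 R).
Implicit Types (A E K S : set (R * R)) (u p x : R * R) (s t h : R).

Definition preserves_lambda2 (f : R * R -> R * R) :=
  measurable_fun setT f /\
  forall E, measurable E -> lambda2 (f @^-1` E) = lambda2 E.

Lemma preserves_lambda2_comp f g : preserves_lambda2 f -> preserves_lambda2 g ->
  preserves_lambda2 (f \o g).
Proof.
move=> [mf pf] [mg pg]; split; first exact: measurableT_comp.
move=> E mE; rewrite comp_preimage pg ?pf//.
by rewrite -[X in measurable X]setTI; exact: mf.
Qed.

Lemma preserves_lambda2_swap : preserves_lambda2 (fun p => (p.2, p.1)).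
Proof.
have ms : measurable_fun setT (fun p : R * R => (p.2, p.1)).
  exact: measurable_fun_pair measurable_snd measurable_fst.
split=> // E mE.
pose T := measurableTypeR R.
pose f (p : T * T) : T * T := (p.2, p.1).
have mf : measurable_fun setT f by exact: ms.
suff : pushforward (leb \x leb)%E f E = (leb \x leb)%E E by [].
symmetry; apply: (@product_measure_unique _ _ _ _ R leb leb
  (pushforward (leb \x leb)%E f)) => // A B mA mB.
have fAB : f @^-1` (A `*` B) = B `*` A by apply/seteqP; split=> -[x y] [].
by rewrite /= /pushforward fAB product_measure1E// muleC.
Qed.

(** The section of the preimage over [x] is a translate, by [a * x], of the section of [E]; the
    inner integrals of Fubini are unchanged. *)
Lemma preserves_lambda2_vshear (a : R) :
  preserves_lambda2 (fun p => (p.1, p.2 + a * p.1)).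
Proof.
have ms : measurable_fun setT (fun p : R * R => (p.1, p.2 + a * p.1)).
  apply: measurable_fun_pair; first exact: measurable_fst.
  apply: measurable_funD; first exact: measurable_snd.
  exact: (measurable_funM (measurable_cst a) measurable_fst).
split=> // E mE; apply: eq_integral => x _ /=.
rewrite -[RHS](@lebesgue_measure_addr _ _ (a * x)); last exact: measurable_xsection.
by congr leb; apply/seteqP; split=> t /=; rewrite /xsection/= !inE.
Qed.

Lemma preserves_lambda2_hshear (a : R) :
  preserves_lambda2 (fun p => (p.1 + a * p.2, p.2)).
Proof.
have := preserves_lambda2_comp preserves_lambda2_swap
  (preserves_lambda2_comp (preserves_lambda2_vshear a) preserves_lambda2_swap).
exact.
Qed.

Lemma preserves_lambda2_rotation (c s : R) : c ^+ 2 + s ^+ 2 = 1 -> s != 0 ->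
  preserves_lambda2 (fun p => (c * p.1 - s * p.2, s * p.1 + c * p.2)).
Proof.
(* For [c] and [s] the cosine and sine of an angle, [b] is minus the tangent of its half. The
   rotation is a vertical shear by [s] between two horizontal shears by [b]. *)
move=> cs s0; pose b := (c - 1) / s.
have := preserves_lambda2_comp (preserves_lambda2_hshear b)
 (preserves_lambda2_comp (preserves_lambda2_vshear s) (preserves_lambda2_hshear b)).
congr preserves_lambda2; apply/funext => -[x y] /=.
have bs : b * s = c - 1 by rewrite /b mulfVK.
have bc : b * (c + 1) = - s.
  rewrite /b mulrAC -subr_sqr expr1n; apply: (mulIf s0); rewrite mulfVK//; lra.
have h1 : b * s * x = (c - 1) * x by rewrite bs.
have h2 : b * s * (b * y) = (c - 1) * (b * y) by rewrite bs.
have h3 : b * (c + 1) * y = - s * y by rewrite bc.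
have h4 : b * s * y = (c - 1) * y by rewrite bs.
congr (_, _); lra.
Qed.

(** The direction [u] carries the second coordinate because [lambda2] integrates the measures of
    vertical sections: these become the sections parallel to [u]. *)
Definition frame u (p : R * R) : R * R := p.1 *: Defs.rot u + p.2 *: u.

Lemma preserves_lambda2_frame u : unit_circle u -> preserves_lambda2 (frame u).
Proof.
case: u => c s; rewrite /unit_circle/dotp/= -!expr2 => cs.
suff H : preserves_lambda2 (fun p => (c * p.1 - s * p.2, s * p.1 + c * p.2)).
  have := preserves_lambda2_comp H preserves_lambda2_swap.
  congr preserves_lambda2; apply/funext => -[x y]; rewrite /frame /=.
  congr (_, _) => /=; rewrite /GRing.scale/=; ring.
(* The three shears require a nonzero sine. Otherwise the rotation is the identity or the half-turn,
   the latter being the square of a quarter-turn. *)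
have [s0|] := eqVneq s 0; last exact: preserves_lambda2_rotation.
move: cs; rewrite s0 expr0n addr0 => /eqP; rewrite sqrf_eq1 => /orP[]/eqP ->.
  rewrite (_ : (fun p => _) = id); last first.
    by apply/funext => -[x y] /=; congr (_, _); ring.
  by split.
have h : preserves_lambda2 (fun p => (0 * p.1 - 1 * p.2, 1 * p.1 + 0 * p.2)).
  by apply: preserves_lambda2_rotation; rewrite ?oner_eq0// expr0n expr1n add0r.
have := preserves_lambda2_comp h h.
by congr preserves_lambda2; apply/funext => -[x y] /=; congr (_, _); ring.
Qed.

(** * Sections by lines parallel to [u] *)

Definition slice u E (s : R) : set R := [set t | E (frame u (s, t))].

Lemma sliceE u E s : slice u E s = xsection (frame u @^-1` E) s.
Proof. by apply/seteqP; split=> t; rewrite /slice /xsection /= inE. Qed.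

Section Slice.
Variables (u : R * R) (E : set (R * R)).
Hypotheses (u1 : unit_circle u) (mE : measurable E).

Let mfE : measurable (frame u @^-1` E).
Proof. by rewrite -[X in measurable X]setTI; apply: (preserves_lambda2_frame u1).1. Qed.

Lemma measurable_slice s : measurable (slice u E s).
Proof. by rewrite sliceE; exact: measurable_xsection. Qed.

Lemma measurable_fun_slice : measurable_fun setT (fun s => leb (slice u E s)).
Proof.
rewrite (_ : (fun s => _) = leb \o xsection (frame u @^-1` E)); last first.
  by apply/funext => s /=; rewrite sliceE.
exact: measurable_fun_xsection.
Qed.

Lemma lambda2_slice : lambda2 E = (\int[leb]_s leb (slice u E s))%E.
Proof.
rewrite -((preserves_lambda2_frame u1).2 _ mE).
by apply: eq_integral => s _; rewrite sliceE.
Qed.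
End Slice.

(** * Measurability, coordinates and bounds for compact sets *)

(** Measurability refers to the product sigma-algebra, so [O] is written as a countable union of
    squares with rational centres. *)
Lemma open_measurable_plane (O : set (R * R)) : open O -> measurable O.
Proof.
move=> oO.
pose Q (q : rat * rat * nat) : set (R * R) :=
  ball (ratr q.1.1 : R) (q.2.+1%:R^-1) `*` ball (ratr q.1.2 : R) (q.2.+1%:R^-1).
have -> : O = \bigcup_q (if `[< Q q `<=` O >] then Q q else set0).
  apply/seteqP; split=> [[x y] Oxy|p [q _]]; last by case: asboolP => // QO /QO.
  have /nbhs_ballP[e e0 eO] : nbhs (x, y) O by exact: open_nbhs_nbhs.
  (* A square of radius below [e / 2] that contains [(x, y)] lies in the ball of radius [e] around
     it. *)
  have [n ne] : exists n, n.+1%:R^-1 < e / 2.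
    have [N] := ltr_add_invr (divr_gt0 e0 (ltr0Sn R 1)).
    by rewrite add0r; exists N.
  pose r : R := n.+1%:R^-1.
  have r0 : 0 < r by rewrite invr_gt0.
  have re : r < e / 2 := ne.
  have app (z : R) : exists q : rat, ball (ratr q : R) r z.
    have [q] : exists q : rat, ratr q \in `]z - r, z + r[ by apply: rat_in_itvoo; lra.
    rewrite in_itv/= => /andP[? ?]; exists q.
    rewrite ball_itv/= in_itv/=; lra.
  have [q1 q1x] := app x; have [q2 q2y] := app y.
  exists (q1, q2, n) => //; case: asboolP => [_ //|[]].
  move=> [x' y'] [/= bx by']; apply: eO; split => /=.
    move: q1x bx; rewrite !ball_itv/= !in_itv/= -/r => /andP[? ?] /andP[? ?].
    by apply/andP; split; lra.
  move: q2y by'; rewrite !ball_itv/= !in_itv/= -/r => /andP[? ?] /andP[? ?].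
  by apply/andP; split; lra.
apply: countable_bigcupT_measurable => // q; case: ifP => // _.
by apply: measurableX; exact: measurable_ball.
Qed.

Lemma compact_measurable_plane (A : set (R * R)) : compact A -> measurable A.
Proof.
move=> cA; rewrite -[A]setCK; apply: measurableC; apply: open_measurable_plane.
apply: closed_openC; apply: compact_closed => //.
Qed.

Lemma translateE x A p : translate x A p = A (p - x).
Proof.
apply/propext; split=> [[a Aa <-]|Ap]; first by rewrite addrK.
by exists (p - x) => //; rewrite subrK.
Qed.

Lemma measurable_translate x A : measurable A -> measurable (translate x A).
Proof.
move=> mA.
rewrite (_ : translate x A = (fun p => (p.1 - x.1, p.2 - x.2)) @^-1` A);
  last first.
  by apply/seteqP; split=> p; rewrite translateE.
rewrite -[X in measurable X]setTI; apply: measurable_fun_pair => //.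
  by apply: measurable_funB => //; exact: measurable_fst.
by apply: measurable_funB => //; exact: measurable_snd.
Qed.

Lemma slice_setD_translate u A s h :
  slice u (A `\` translate (h *: u) A) s =
  slice u A s `\` [set t | slice u A s (t - h)].
Proof.
apply/seteqP; split=> t; rewrite /slice /frame/= translateE scalerBl addrA;
by move=> [].
Qed.

(** The parametrisation behind [lambda1_par] stays on the line, so intersecting with that line
    changes nothing. This turns both hypotheses into statements on slices. *)
Lemma lambda1_par_slice u S s :
  lambda1_par u (s *: Defs.rot u)
    (S `&` translate (s *: Defs.rot u) (dir_line u)) =
  leb (slice u S s).
Proof.
rewrite /lambda1_par /lambda1 /pushforward; congr leb; apply/seteqP; split=> t.
  by case.
move=> St; split=> //=; rewrite translateE addrAC subrr add0r.
by exists t.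
Qed.

Lemma lambda1_orthE u S : lambda1_orth u S = leb [set s | S (s *: Defs.rot u)].
Proof.
rewrite /lambda1_orth /lambda1 /pushforward; congr leb; apply/seteqP; split=> s /=;
by rewrite add0r.
Qed.

Lemma dotp_frame_rot u s t : unit_circle u -> dotp (frame u (s, t)) (Defs.rot u) = s.
Proof.
case: u => c d; rewrite /unit_circle /frame /dotp/= /GRing.scale /= => cd.
transitivity (s * (c * c + d * d)); [ring|by rewrite cd mulr1].
Qed.

Lemma dotp_frame u s t : unit_circle u -> dotp (frame u (s, t)) u = t.
Proof.
case: u => c d; rewrite /unit_circle /frame /dotp/= /GRing.scale /= => cd.
transitivity (t * (c * c + d * d)); [ring|by rewrite cd mulr1].
Qed.

Lemma frame_dotp u p : unit_circle u -> frame u (dotp p (Defs.rot u), dotp p u) = p.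
Proof.
case: u p => c d [x y]; rewrite /unit_circle /frame /dotp/= => cd.
rewrite /GRing.scale /= /scale_pair /= /GRing.scale /=.
congr (_, _).
  transitivity (x * (c * c + d * d)); [rewrite /=; ring|by rewrite cd mulr1].
transitivity (y * (c * c + d * d)); [rewrite /=; ring|by rewrite cd mulr1].
Qed.

Lemma dotpB p q x : dotp (p - q) x = dotp p x - dotp q x.
Proof. by rewrite /dotp/=; ring. Qed.

Lemma dotpZ a p x : dotp (a *: p) x = a * dotp p x.
Proof. by rewrite /dotp/= /GRing.scale/=; ring. Qed.

Lemma continuous_dotp x : continuous (fun p => dotp p x).
Proof.
by move=> p; apply: cvgD; (apply: cvgM; last exact: cvg_cst);
  [exact: cvg_fst|exact: cvg_snd].
Qed.

Lemma slice_nonempty u A s t : unit_circle u -> slice u A s t ->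
  exists2 p, A p & dotp p (Defs.rot u) = s.
Proof. by move=> u1 Ast; exists (frame u (s, t)) => //; rewrite dotp_frame_rot. Qed.

Lemma compact_sub_box A : compact A ->
  exists2 M : R, 0 < M & A `<=` `[- M, M] `*` `[- M, M].
Proof.
move=> /compact_bounded[N [_ N1]]; exists (`|N| + 1); first by rewrite ltr_wpDl.
move=> [x y] /(N1 (`|N| + 1)) /=.
rewrite (le_lt_trans (ler_norm N)) ?ltrDl// => /(_ isT).
rewrite prod_normE/= ge_max => /andP[? ?].
by split; rewrite /= in_itv/= -ler_norml.
Qed.

Lemma compact_lambda2_lty A : compact A -> (lambda2 A < +oo)%E.
Proof.
move=> cA; have [M M0 AM] := compact_sub_box cA.
apply: (@le_lt_trans _ _ (lambda2 (`[- M, M] `*` `[- M, M]))).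
  apply: (@le_measure _ _ _ (leb \x leb)%E) => //; rewrite inE.
    exact: compact_measurable_plane.
  exact: measurableX.
rewrite /lambda2 product_measure1E//= lebesgue_measure_itv/= lte_fin.
by case: ifP => _; rewrite ?mule0 ?ltry// -EFinB -EFinM ltry.
Qed.

Lemma compact_slice_lty u A s :
  unit_circle u -> compact A -> (leb (slice u A s) < +oo)%E.
Proof.
move=> u1 cA; have [M M0 AM] := compact_sub_box cA.
apply: (@le_lt_trans _ _ (leb `[(- (M + M))%R, (M + M)%R])).
  apply: le_lebesgue_measure => t At; rewrite /= in_itv/= -ler_norml.
  rewrite -(dotp_frame s t u1); have := AM _ At.
  case: (frame u (s, t)) => x y [] /=; rewrite !in_itv/= -!ler_norml => xM yM.
  have u1le : `|u.1| <= 1 /\ `|u.2| <= 1.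
    move: u1; rewrite /unit_circle /dotp/= -!expr2 => u1.
    by split; rewrite -(@expr_le1 _ 2)// real_normK ?num_real// -u1 ?lerDl ?lerDr
      sqr_ge0.
  rewrite /dotp/= (le_trans (ler_normD _ _))// lerD// normrM -[leRHS]mulr1;
    apply: ler_pM => //; by case: u1le.
by rewrite lebesgue_measure_itv/= lte_fin; case: ifP => // _; rewrite -EFinB ltry.
Qed.

(** * Convex bodies and covariograms *)

Lemma convex_set_comb K a b t :
  @convex_set R (R * R)%type K -> K a -> K b -> 0 <= t -> t <= 1 ->
  K (t *: a + (1 - t) *: b).
Proof.
move=> cK Ka Kb t0 t1.
by have /set_mem := cK a b (Itv01 t0 t1) (mem_set Ka) (mem_set Kb).
Qed.

Lemma lambda2_setD_translate A K x : compact A -> compact K ->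
  covariogram A = covariogram K ->
  lambda2 (A `\` translate x A) = lambda2 (K `\` translate x K).
Proof.
move=> cA cK gE.
have D (B : set (R * R)) : compact B ->
    lambda2 (B `\` translate x B) = (covariogram B 0%R - covariogram B x)%E.
  move=> cB; have mB := compact_measurable_plane cB.
  rewrite /covariogram.
  have -> : B `&` translate 0 B = B.
    by apply/seteqP; split=> p //=; rewrite ?translateE ?subr0//; case.
  apply: (@measureD _ _ _ (leb \x leb)%E) => //; first exact: measurable_translate.
  exact: compact_lambda2_lty.
by rewrite !D// gE.
Qed.

Lemma covariogram_convex_body_gt0 K a b t : convex_body K -> K a -> K b ->
  0 < t -> t < 1 -> (0 < covariogram K ((1 - t) *: (a - b)))%E.
Proof.
move=> [cK vK [p /nbhs_ballP[e e0 eK]]] Ka Kb t0 t1; rewrite /= in e0.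
set x := _ *: _.
(* The homothety sending [k] to [(1 - t) *: a + t *: k] maps [p] to [q], and the ball around [p]
   inside [K] to [Q]. *)
pose q := (1 - t) *: a + t *: p.
pose Q := ball q.1 (t * e) `*` ball q.2 (t * e).
have te0 : 0 < t * e by rewrite mulr_gt0.
(* [K `&` (K + x)] contains [(1 - t) a + t K]. *)
have QK : Q `<=` K `&` translate x K.
  move=> z [z1 z2]; pose w := p + t^-1 *: (z - q).
  have Kw : K w.
    apply: eK; move: z1 z2; rewrite /ball/= /ball_/= => z1 z2.
    by split; rewrite /= /ball /= opprD addrA subrr sub0r normrN normrM
      gtr0_norm ?invr_gt0// ltr_pdivrMl// distrC.
  have zE : z = t *: w + (1 - t) *: a.
    by rewrite /w scalerDr scalerA divff ?gt_eqF// scale1r addrC addrA -/q addrC subrK.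
  split; first by rewrite zE; apply: convex_set_comb => //; exact: ltW.
  (* Subtracting [x] replaces [a] by [b]: the point [z - x] is [t *: w + (1 - t) *: b]. *)
  rewrite translateE zE /x scalerBr opprB -addrA.
  rewrite [(1 - t) *: a + _]addrC subrK.
  by apply: convex_set_comb => //; exact: ltW.
have mK := compact_measurable_plane cK.
apply: (@lt_le_trans _ _ (lambda2 Q)).
  rewrite /lambda2 product_measure1E//=; [|exact: measurable_ball..].
  by rewrite !lebesgue_measure_ball ?(ltW te0)// mule_gt0// lte_fin mulrn_wgt0.
apply: (@le_measure _ _ _ (leb \x leb)%E) => //; rewrite inE.
  by apply: measurableX; exact: measurable_ball.
by apply: measurableI => //; exact: measurable_translate.
Qed.

Lemma convex_lambda2_setD_le u K a b h : unit_circle u -> compact K ->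
  @convex_set R (R * R)%type K -> 0 < h -> a <= b ->
  (forall p, K p -> a <= dotp p (Defs.rot u) <= b) ->
  (lambda2 (K `\` translate (h *: u) K) <= (h * (b - a))%:E)%E.
Proof.
move=> u1 cK vK h0 ab Kab.
have mK := compact_measurable_plane cK.
have mD : measurable (K `\` translate (h *: u) K).
  by apply: measurableD => //; exact: measurable_translate.
rewrite (lambda2_slice u1 mD).
(* Slices over [[a, b]] are intervals and lose at most [h]; all other slices are empty. *)
apply: (@le_trans _ _ (\int[leb]_s (h%:E * (\1_(`[a, b]%classic) s)%:E))%E).
  apply: ge0_le_integral => //.
  - by have := measurable_fun_slice u1 mD.
  - apply: emeasurable_funM; first exact: measurable_cst.
    apply/measurable_EFinP; exact: measurable_indic.
  - move=> s _; rewrite slice_setD_translate indicE.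
    have [sab|sab] := boolP (s \in `[a, b]%classic).
      rewrite mule1; apply: convex_shift_setD_le => // t t' Kt Kt' r /andP[tr rt'].
      have [tt'|tt'] := eqVneq t t'.
        have -> : r = t by apply: le_anti; rewrite tr andbT tt' rt'.
        by [].
      have d0 : 0 < t' - t by rewrite subr_gt0 lt_neqAle tt' (le_trans tr).
      (* The weight for which [r] is [l * t + (1 - l) * t']. *)
      pose l := (t' - r) / (t' - t).
      have l0 : 0 <= l by apply: divr_ge0; [rewrite subr_ge0|exact: ltW].
      have l1 : l <= 1 by rewrite ler_pdivrMr// mul1r lerB.
      have := convex_set_comb vK Kt Kt' l0 l1; rewrite /slice /=.
      congr K; rewrite /frame /= !scalerDr addrACA -scalerDl [l + _]addrC subrK scale1r.
      rewrite !scalerA -scalerDl; congr (_ + _ *: _).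
      rewrite /l; field. by rewrite gt_eqF.
    rewrite mule0 (_ : _ `\` _ = set0) ?measure0//.
    apply/seteqP; split=> // t [/(slice_nonempty u1)[p Kp ps] _].
    by case/negP: sab; apply/mem_set; rewrite /= in_itv/= -ps Kab.
rewrite ge0_integralZl//; last 2 first.
  - by apply/measurable_EFinP; exact: measurable_indic.
  - by rewrite lee_fin ltW.
rewrite integral_indic//= setIT lebesgue_measure_itv/= lte_fin EFinM.
rewrite lee_pmul2l//; case: ifP => _; first by rewrite EFinB.
by rewrite lee_fin subr_ge0.
Qed.

(** * Projections and widths *)

(** This makes hypothesis (1) available at every [s] between two values attained on [A], even where
    the projection of [A] has gaps. *)
Lemma conv_hull_orth_proj u A p q s : unit_circle u -> A p -> A q ->
  dotp p (Defs.rot u) <= s <= dotp q (Defs.rot u) ->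
  conv_hull (orth_proj u A) (s *: Defs.rot u).
Proof.
move=> u1 Ap Aq /andP[ps sq] C [vC AC].
have P r : A r -> C (dotp r (Defs.rot u) *: Defs.rot u).
  move=> Ar; apply: AC; exists r => //.
  by rewrite -[X in X - _](frame_dotp r u1) /frame /= addrK.
have [pq|pq] := eqVneq (dotp p (Defs.rot u)) (dotp q (Defs.rot u)).
  by rewrite (_ : s = dotp p (Defs.rot u)); [exact: P|apply: le_anti; rewrite ps pq sq].
set b := dotp q _ in sq pq *; set a := dotp p _ in ps pq *.
have d0 : 0 < b - a by rewrite subr_gt0 lt_neqAle pq (le_trans ps).
pose l := (b - s) / (b - a).
have l0 : 0 <= l by apply: divr_ge0; [rewrite subr_ge0|exact: ltW].
have l1 : l <= 1 by rewrite ler_pdivrMr// mul1r lerB.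
have := convex_set_comb vC (P _ Ap) (P _ Aq) l0 l1.
congr C; rewrite -/a -/b !scalerA -scalerDl; congr (_ *: _).
rewrite /l; field. by rewrite gt_eqF.
Qed.

Lemma le_width_slice_gt0 u A p q : unit_circle u -> measurable A ->
  {ae lambda1_orth u, forall y, conv_hull (orth_proj u A) y ->
     (0 < lambda1_par u y (A `&` translate y (dir_line u)))%E} ->
  A p -> A q -> dotp p (Defs.rot u) <= dotp q (Defs.rot u) ->
  ((dotp q (Defs.rot u) - dotp p (Defs.rot u))%:E <=
    leb [set s | (0 < leb (slice u A s))%E])%E.
Proof.
move=> u1 mA [N [mN N0 sN]] Ap Aq pq.
set a := dotp p _ in pq *; set b := dotp q _ in pq *.
(* The exceptional set [N] lives in the plane; [N'] is its trace on the line spanned by [rot u],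
   null because [lambda1_orth] is a pushforward. Together with the positive slices it covers
   [[a, b]]. *)
pose N' := [set s : R | N (s *: Defs.rot u)].
have mN' : measurable N'.
  rewrite -[X in measurable X]setTI.
  have : measurable_fun setT (fun s : R => (s * (Defs.rot u).1, s * (Defs.rot u).2)).
    by apply: measurable_fun_pair; apply: measurable_funM.
  by apply.
have mP : measurable [set s | (0 < leb (slice u A s))%E].
  rewrite -[X in measurable X]setTI; apply: emeasurable_fun_o_infty => //.
  exact: measurable_fun_slice.
have -> : (b - a)%:E = leb `[a, b].
  rewrite lebesgue_measure_itv/= lte_fin; move: pq.
  by rewrite le_eqVlt => /orP[/eqP abE|->//]; rewrite abE ltxx subrr.
apply: (@le_trans _ _ (leb (N' `|` [set s | (0 < leb (slice u A s))%E]))).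
  apply: le_lebesgue_measure => s /=; rewrite in_itv/= => sab.
  have [?|nN] := pselect (N' s); [by left|right].
  apply: contrapT => /= P0; apply: nN; apply: sN => /= H; apply: P0.
  rewrite -lambda1_par_slice; apply: H.
  exact: (conv_hull_orth_proj u1 Ap Aq).
apply: (le_trans (measureU2 leb mN' mP)).
have N'0 : leb N' = 0%E by rewrite -N0 lambda1_orthE.
by rewrite /= N'0 add0e.
Qed.

Lemma covariogram_eq_difference A K p q t : compact A -> convex_body K ->
  covariogram A = covariogram K -> K p -> K q -> 0 < t -> t < 1 ->
  exists a b, [/\ A a, A b & a - b = (1 - t) *: (p - q)].
Proof.
move=> cA bK gE Kp Kq t0 t1.
have : (0 < covariogram A ((1 - t) *: (p - q)))%E.
  by rewrite gE; exact: covariogram_convex_body_gt0.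
have [[a [Aa]]|A0 ] := pselect (A `&` translate ((1 - t) *: (p - q)) A !=set0).
  rewrite translateE => Ab _; exists a, (a - (1 - t) *: (p - q)); split=> //.
  by rewrite opprB addrC subrK.
move/nonemptyPn: A0 => A0.
by rewrite /covariogram A0 /Defs.lambda2 measure0 ltxx.
Qed.

(** * Rates along the shifts [1 / (n + 1)] and the final contradiction *)

Lemma limn_einf_cst (c : \bar R) : limn_einf (fun=> c) = c.
Proof. by have [-> _] := cvg_limn_einf_sup (cvg_cst c). Qed.

(** Fatou's lemma needs a sequence. Restricting to the shifts [n.+1%:R^-1] can only raise the lower
    limit, which preserves the bound 2 of hypothesis (2). *)
Lemma section_rate_le u A s : (section_rate A u (s *: Defs.rot u) <=
  limn_einf (fun n =>
    leb (slice u A s `\` [set t | slice u A s (t - n.+1%:R^-1)%R])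
    * ((n.+1%:R^-1)^-1)%:E))%E.
Proof.
have h0 : (n.+1%:R^-1 : R) @[n --> \oo] --> 0^'+.
  by apply: cvg_at_right0 => [n|]; [rewrite invr_gt0|exact: cvg_harmonic].
apply: (le_trans (limf_einf_le_limn_einf _ h0)).
apply: le_limn_einf => n /=.
by rewrite lambda1_par_slice slice_setD_translate.
Qed.

End Plane.

Theorem proposition3p5 (R : realType) (A : set (R * R)) :
  regular_compact A ->
  (exists u : R * R,
    [/\ unit_circle u,
        {ae lambda1_orth u, forall y, conv_hull (orth_proj u A) y ->
          (0 < lambda1_par u y (A `&` translate y (dir_line u)))%E}
      & (0 < lambda1_orth u
               [set y | orth_line u y /\ (2%:E <= section_rate A u y)%E])%E]) ->
  forall K : set (R * R), convex_body K -> covariogram A <> covariogram K.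
Proof.
move=> [cA _] [u [u1 aeA G0]] K bK gE.
have [cK vK [p0 /interior_subset Kp0]] := bK.
pose leb := @lebesgue_measure R.
have mA := compact_measurable_plane cA.
have mAh (h : R) : measurable (A `\` translate (h *: u) A).
  by apply: measurableD => //; exact: measurable_translate.
have K0 : K !=set0 by exists p0.
have cdot := continuous_subspaceT (A := K) (@continuous_dotp R (Defs.rot u)).
have [k1 /set_mem Kk1 k1max] := compact_EVT_max K0 cK cdot.
have [k2 /set_mem Kk2 k2min] := compact_EVT_min K0 cK cdot.
pose w := dotp k1 (Defs.rot u) - dotp k2 (Defs.rot u).
have w0 : 0 <= w by rewrite subr_ge0 k1max// inE.
pose P := [set s | (0 < leb (slice u A s))%E].
have wP : (w%:E <= leb P)%E.
  (* The covariogram of [K] may vanish at [k1 - k2] itself, so the bound is first proved for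
     shrunken differences, then [t] is made small. *)
  have wt (t : R) : 0 < t -> t < 1 -> (((1 - t) * w)%:E <= leb P)%E.
    move=> t0 t1.
    have [a [b [Aa Ab abE]]] := covariogram_eq_difference cA bK gE Kk1 Kk2 t0 t1.
    have dE : dotp a (Defs.rot u) - dotp b (Defs.rot u) = (1 - t) * w.
      by rewrite -dotpB abE dotpZ dotpB.
    rewrite -dE; apply: (le_width_slice_gt0 u1 mA aeA Ab Aa).
    by rewrite -subr_ge0 dE mulr_ge0// subr_ge0 ltW.
  case E : (leb P) wt => [r| |] wt; last 2 first.
  - by rewrite leey.
  - by have := wt 2^-1 _ _; rewrite leeNy_eq; apply => //; lra.
  rewrite lee_fin leNgt; apply/negP => rw.
  have r0 : 0 <= r.
    have w2r : (1 - 2^-1) * w <= r by rewrite -lee_fin; apply: wt; lra.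
    by rewrite (le_trans _ w2r)// mulr_ge0//; lra.
  have w1 : 0 < w by exact: le_lt_trans rw.
  (* With this choice [(1 - t) * w] is the midpoint of [r] and [w], hence exceeds [r]. *)
  pose t := (w - r) / (w *+ 2).
  have t0 : 0 < t by rewrite divr_gt0 ?subr_gt0// mulrn_wgt0.
  have t1 : t < 1 by rewrite ltr_pdivrMr ?mulrn_wgt0// mul1r mulr2n; lra.
  have tw : t * w = (w - r) / 2 by rewrite /t -mulr_natr; field; rewrite gt_eqF.
  have := wt t t0 t1; rewrite lee_fin mulrBl tw; lra.
pose phi n s : \bar R :=
  (leb (slice u A s `\` [set t | slice u A s (t - n.+1%:R^-1)%R])
    * ((n.+1%:R^-1)^-1)%:E)%E.
pose D n := A `\` translate (n.+1%:R^-1 *: u) A.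
have phiE n s : phi n s = (leb (slice u (D n) s) * (n.+1%:R)%:E)%E.
  by rewrite /phi /D slice_setD_translate invrK.
have phi0 n s : (0 <= phi n s)%E by rewrite phiE mule_ge0.
have mphi n : measurable_fun setT (phi n).
  apply: emeasurable_funM; last exact: measurable_cst.
  rewrite (_ : (fun s => _) = (fun s => leb (slice u (D n) s))).
    exact: (measurable_fun_slice u1 (mAh _)).
  by apply/funext => s; rewrite /D slice_setD_translate.
pose F s := limn_einf (phi ^~ s).
have mF : measurable_fun setT F.
  apply: measurableT_comp => //.
  by apply: measurable_fun_limn_esup => n; exact: measurableT_comp.
(* A measurable set containing all parameters from hypothesis (2), since [F] dominates
   [section_rate]. *)
pose G := [set s | (2%:E <= F s)%E].
have mG : measurable G.
  by rewrite -[X in measurable X]setTI; apply: emeasurable_fun_c_infty.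
have mP : measurable P.
  rewrite -[X in measurable X]setTI; apply: emeasurable_fun_o_infty => //.
  exact: measurable_fun_slice.
have {}G0 : (0 < leb G)%E.
  apply: (lt_le_trans G0); rewrite lambda1_orthE.
  apply: le_lebesgue_measure => s /= [_ sF].
  exact: (le_trans sF (section_rate_le u A s)).
have F0 s : (0 <= F s)%E.
  rewrite -(limn_einf_cst 0%E).
  exact: le_limn_einf.
have F1 s : P s -> (1 <= F s)%E.
  move=> Ps; apply: einf_shift_rate_ge1 => //; first exact: measurable_slice.
  exact: compact_slice_lty.
(* Pointwise, the indicators of [P] and [G] sum to at most [F]: on [G] the sum is at most 2, and off
   [G] only the bound 1 on [P] is needed. *)
have PGF : (leb P + leb G <= \int[leb]_s F s)%E.
  have mI (B : set R) :
      measurable B -> measurable_fun setT (EFin \o (\1_B : R -> R)).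
    by move=> mB; apply/measurable_EFinP; exact: measurable_indic.
  have -> : (leb P + leb G = \int[leb]_s ((\1_P s)%:E + (\1_G s)%:E))%E.
    rewrite ge0_integralD//; [|exact: mI..].
    by rewrite !integral_indic//= !setIT.
  apply: ge0_le_integral => //.
  - by move=> s _; rewrite adde_ge0 ?lee_fin.
  - exact: (emeasurable_funD (mI _ mP) (mI _ mG)).
  move=> s _; rewrite !indicE; have [sG|_] := boolP (s \in G).
    apply: (@le_trans _ _ 2%:E); last by move/set_mem: sG.
    by rewrite -EFinD lee_fin; case: (s \in P) => /=; lra.
  by rewrite adde0; case: (boolP (s \in P)) => // /set_mem/F1.
(* By Fubini the integral of [phi n] is [n.+1] times the measure of [D n]. The equal covariograms
   replace [A] by [K] there, which gives at most [w] for every [n]. *)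
have Fw : (\int[leb]_s F s <= w%:E)%E.
  apply: (le_trans (fatou leb measurableT mphi (fun n s _ => phi0 n s))).
  rewrite -[leRHS]limn_einf_cst.
  apply: le_limn_einf => n /=.
  under eq_integral do rewrite phiE.
  rewrite ge0_integralZr//; last by have := measurable_fun_slice u1 (mAh n.+1%:R^-1).
  have h0 : 0 < n.+1%:R^-1 :> R by rewrite invr_gt0.
  rewrite -(lambda2_slice u1 (mAh _)) (lambda2_setD_translate _ cA cK gE).
  apply: (@le_trans _ _ ((n.+1%:R^-1 * w)%:E * n.+1%:R%:E)%E); last first.
    by rewrite -EFinM mulrAC mulVf ?mul1r// pnatr_eq0.
  apply: lee_wpmul2r; first by rewrite lee_fin.
  apply: convex_lambda2_setD_le => //; first by rewrite k1max// inE.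
  by move=> p Kp; rewrite k2min ?inE// k1max ?inE.
(* As [w] is finite it cancels, contradicting the positive measure of [G]. *)
have : (w%:E + leb G <= w%:E)%E.
  by rewrite (le_trans _ Fw)// (le_trans _ PGF)// leeD2r.
by rewrite -[leRHS]adde0 leeD2lE// leNgt G0.
Qed.
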